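(* Let $\mathcal H$ be a real Hilbert space, $t_0>0$, let $f\in\mathcal C^2(\mathcal H)$ be convex with nonempty set of minimizers, and let $e\in\mathcal C^1([t_0,+\infty[;\mathcal H)$ with $\int_{t_0}^{+\infty}t\|e(t)\|dt<+\infty$ and $\int_{t_0}^{+\infty}t\|\dot e(t)\|dt<+\infty$. Let $\alpha>3$, $\beta>0$, and let $x$ be a solution trajectory of $$\ddot x(t)+\frac{\alpha}{t}\dot x(t)+\beta\frac{d}{dt}\big(\nabla f(x(t))+e(t)\big)+\nabla f(x(t))+e(t)=0.$$ Then $x(t)$ converges weakly, as $t\to+\infty$, to a minimizer of $f$. *)

(* Defs.v *)
From HB Require Import structures.
From mathcomp Require Import all_boot all_order all_algebra.
From mathcomp Require Import all_classical all_reals all_analysis.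
Set Implicit Arguments. Unset Strict Implicit. Unset Printing Implicit Defensive.
Import Order.TTheory GRing.Theory Num.Theory.
Import numFieldNormedType.Exports.
Local Open Scope classical_set_scope.
Local Open Scope ring_scope.

(* A real Hilbert space: a complete real normed space whose norm is induced by
   a symmetric bilinear inner product (<x,x> = ||x||^2). *)
Record inner_product (R : realType) (V : normedModType R) := InnerProduct {
  inner : V -> V -> R;
  inner_sym : forall x y, inner x y = inner y x;
  inner_linl : forall (a : R) x y z, inner (a *: x + y) z = a * inner x z + inner y z;
  inner_norm : forall x, inner x x = `|x| ^+ 2
}.

Definition is_gradient (R : realType) (V : normedModType R) (ip : inner_product V)
  (f : V -> R) (g : V -> V) : Prop :=
  forall x, differentiable f x /\ forall h, 'd f x h = inner ip (g x) h.

(* f is of class C^2 with gradient g: g is Frechet differentiable everywhere and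
   its derivative x |-> Dg(x) is continuous for the operator norm. *)
Definition C2_with_gradient (R : realType) (V : normedModType R) (ip : inner_product V)
  (f : V -> R) (g : V -> V) : Prop :=
  is_gradient ip f g /\
  (forall x, differentiable g x) /\
  (forall x (eps : R), 0 < eps -> exists2 delta : R, 0 < delta &
     forall y, `|y - x| < delta -> forall h, `|'d g y h - 'd g x h| <= eps * `|h|).

Definition convex_fun (R : realType) (V : normedModType R) (f : V -> R) : Prop :=
  forall (x y : V) (l : R), 0 <= l <= 1 ->
    f (l *: x + (1 - l) *: y) <= l * f x + (1 - l) * f y.

Definition is_minimizer (R : realType) (V : normedModType R) (f : V -> R) (z : V) : Prop :=
  forall y, f z <= f y.

Definition weak_cvg_pinfty (R : realType) (V : normedModType R) (ip : inner_product V)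
  (x : R -> V) (z : V) : Prop :=
  forall y, (fun t => inner ip (x t) y) @ +oo --> inner ip z y.

(* Main.v *)
(* Write p = grad f (x) + e and w = x' + beta p, so that w' = - (alpha / t) x' - p.
   For a minimizer z and 2 < lam < alpha - 1, the Lyapunov function
     (t^2 + t beta (alpha - lam - 2)) (f x - f z)
       + |lam (x - z) + t w|^2 / 2 + lam (alpha - 1 - lam) / 2 |x - z|^2
   satisfies E' <= - (beta / 4) t^2 |p|^2 + C t |e| (1 + E) for large t; the integrability of
   t |e'| enters only through the boundedness of t |e|.  Gronwall's lemma gives that E is
   bounded and convergent, that f x -> f z and that t^2 |p|^2 is integrable.  As E is affine
   in lam, comparing two values of lam shows that (alpha - 1) / 2 |x - z|^2 + t <x - z, w>
   converges; since <x - z, p> is integrable, an Euler-type linear equation then yields the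
   convergence of |x - z|.  Opial's lemma concludes: weak limits of x along ultrafilters
   exist by Riesz representation, are minimizers by the gradient inequality, and are all
   equal because |x - z| converges for every minimizer z. *)
Require Import Defs.
From HB Require Import structures.
From mathcomp Require Import all_boot all_order all_algebra.
From mathcomp Require Import all_classical all_reals all_analysis.
From mathcomp Require Import ring lra.
Import Order.TTheory GRing.Theory Num.Theory.
Import numFieldNormedType.Exports.
Local Open Scope classical_set_scope.
Local Open Scope ring_scope.

Set Implicit Arguments.
Unset Strict Implicit.
Unset Printing Implicit Defensive.

(** * Real functions at infinity *)

Section RealFunctions.
Context {R : realType}.
Implicit Types (F G dF dG : R -> R) (T c l : R).

Lemma is_derive_ge0_nondecreasing T F dF :
  (forall t, T < t -> is_derive t 1 F (dF t)) ->
  (forall t, T < t -> 0 <= dF t) ->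
  forall s t, T < s -> s <= t -> F s <= F t.
Proof.
move=> FdF dF0 s t Ts st.
have Fs y : s <= y -> is_derive y 1 F (dF y).
  by move=> sy; apply: FdF; exact: lt_le_trans sy.
apply: (@ger0_derive1_ndecr R F s t) => //.
- move=> y; rewrite in_itv/= => /andP[sy _].
  by have [] := Fs _ (ltW sy).
- move=> y; rewrite in_itv/= => /andP[sy _].
  by rewrite derive1E (@derive_val _ _ _ _ _ _ _ (Fs _ (ltW sy))) dF0// (lt_trans Ts).
- apply: derivable_within_continuous => y; rewrite in_itv/= => /andP[sy _].
  by have [] := Fs _ sy.
Qed.

Lemma is_derive_le0_nonincreasing T F dF :
  (forall t, T < t -> is_derive t 1 F (dF t)) ->
  (forall t, T < t -> dF t <= 0) ->
  forall s t, T < s -> s <= t -> F t <= F s.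
Proof.
move=> FdF dF0 s t Ts st; rewrite -lerN2.
apply: (@is_derive_ge0_nondecreasing T (- F) (- dF)) st => // y Ty.
  by apply: is_deriveN; exact: FdF.
by rewrite oppr_ge0 dF0.
Qed.

Lemma nondecreasing_bounded_cvgy T F M :
  (forall s t, T < s -> s <= t -> F s <= F t) ->
  (forall t, T < t -> F t <= M) ->
  cvg (F t @[t --> +oo]).
Proof.
(* Freezing [F] below [T + 1] gives a function monotone on the whole line with the same behaviour at
   infinity. *)
move=> ndF FM; pose G t := F (Num.max t (T + 1)).
have T1 t : T < Num.max t (T + 1) by rewrite lt_max ltrDl ltr01 orbT.
have cG : cvg (G t @[t --> +oo]).
  apply/cvg_ex; exists (sup (range G)); apply: nondecreasing_cvgr.
    move=> s t st; apply: ndF => //.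
    by rewrite ge_max !le_max st lexx orbT.
  by exists M => _ [t _ <-]; exact: FM.
move/cvg_ex : cG => [l Gl]; apply/cvg_ex; exists l; apply: cvg_trans Gl.
apply: near_eq_cvg; near=> t; rewrite /G max_l//; near: t; apply: nbhs_pinfty_ge; exact: num_real.
Unshelve. all: by end_near. Qed.

Lemma nonincreasing_bounded_cvgy T F m :
  (forall s t, T < s -> s <= t -> F t <= F s) ->
  (forall t, T < t -> m <= F t) ->
  cvg (F t @[t --> +oo]).
Proof.
move=> niF mF; rewrite -is_cvgNE.
apply: (@nondecreasing_bounded_cvgy T _ (- m)).
  by move=> s t Ts st; rewrite lerN2; exact: niF.
by move=> t Tt; rewrite lerN2; exact: mF.
Qed.

(** Comparison test: [F] is the difference of [F + G] and [G], both nondecreasing and bounded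
    above. *)
Lemma is_derive_dominated_cvgy T F dF G dG M :
  (forall t, T < t -> is_derive t 1 F (dF t)) ->
  (forall t, T < t -> is_derive t 1 G (dG t)) ->
  (forall t, T < t -> `|dF t| <= dG t) ->
  (forall t, T < t -> G t <= M) ->
  cvg (F t @[t --> +oo]).
Proof.
move=> FdF GdG dFG GM.
have ndG : forall s t, T < s -> s <= t -> G s <= G t.
  apply: (is_derive_ge0_nondecreasing GdG) => t Tt.
  exact: le_trans (normr_ge0 _) (dFG _ Tt).
have niFG : forall s t, T < s -> s <= t -> F t - G t <= F s - G s.
  apply: (@is_derive_le0_nonincreasing T (F - G) (dF - dG)) => t Tt.
    by apply: is_deriveB; [exact: FdF|exact: GdG].
  by rewrite subr_le0 (le_trans (ler_norm _))// dFG.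
have ndFG : forall s t, T < s -> s <= t -> F s + G s <= F t + G t.
  apply: (@is_derive_ge0_nondecreasing T (F + G) (dF + dG)) => t Tt.
    by apply: is_deriveD; [exact: FdF|exact: GdG].
  by have := dFG _ Tt; rewrite ler_norml => /andP[+ _] /=; rewrite -subr_ge0 opprK.
have cG : cvg (G t @[t --> +oo]) := nondecreasing_bounded_cvgy ndG GM.
rewrite (_ : F = (F + G) - G); last by rewrite addrK.
apply: is_cvgB => //.
(* The bound comes from writing [F + G] as [F - G], which is nonincreasing, plus twice [G]. *)
apply: (@nondecreasing_bounded_cvgy (T + 1) _
  (F (T + 1) - G (T + 1) + M + M)).
  by move=> s t Ts st; apply: ndFG => //; rewrite (lt_trans _ Ts)// ltrDl.
move=> t Tt.
have TT : T < T + 1 by rewrite ltrDl.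
have := niFG _ _ TT (ltW Tt); have := GM t (lt_trans TT Tt).
rewrite [X in _ -> _ -> X <= _](_ : _ = F t + G t)//.
lra.
Qed.

Lemma cvgy_bounded F : cvg (F t @[t --> +oo]) ->
  exists T M, forall t, T < t -> `|F t| <= M.
Proof.
move=> /cvg_ex[l /cvgrPdist_le /(_ _ ltr01)[T [_ Tl]]].
exists T, (`|l| + 1) => t Tt.
have -> : F t = l - (l - F t) by rewrite opprB addrC subrK.
by rewrite (le_trans (ler_normB _ _))// lerD2l; exact: Tl.
Qed.

(* Integrating factor [t ^ a]: [(t ^ a q)' = t ^ (a - 1) (a q + t q')]. *)
Lemma cvgy_euler_ode_le (a T c : R) q dq : 0 < a -> 0 <= T ->
  (forall t, T < t -> is_derive t 1 q (dq t)) ->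
  (forall t, T < t -> a * q t + t * dq t <= a * c) ->
  forall eps, 0 < eps -> \forall t \near +oo, q t <= c + eps.
Proof.
move=> a0 T0 qdq qc eps eps0.
pose G t := t `^ a * (q t - c).
pose dG t := t `^ a * dq t + (q t - c) * (a * t `^ (a - 1)).
have GdG t : T < t -> is_derive t 1 G (dG t).
  move=> Tt; have t0 : 0 < t by exact: le_lt_trans Tt.
  apply: (@is_deriveM _ _ (fun t => t `^ a) (fun t => q t - c) t 1 (a * t `^ (a - 1)) (dq t)).
    exact: is_derive1_powR.
  rewrite -[X in is_derive _ _ _ X]subr0; apply: is_deriveB; exact: qdq.
have niG : forall s t, T < s -> s <= t -> G t <= G s.
  apply: (is_derive_le0_nonincreasing GdG) => t Tt.
  have t0 : 0 < t by exact: le_lt_trans Tt.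
  rewrite /dG.
  have -> : t `^ a = t * t `^ (a - 1).
    by rewrite -{2}(powRr1 (ltW t0)) -powRD ?(gt_eqF t0) ?implybT// subrKC.
  rewrite (_ : _ + _ = t `^ (a - 1) * (a * q t + t * dq t - a * c)); last by ring.
  by rewrite mulr_ge0_le0 ?powR_ge0// subr_le0 qc.
have TT : T < T + 1 by rewrite ltrDl.
(* The maximum keeps [K] positive whatever the sign of [G (T + 1)]; once [t ^ a >= K / eps], the
   initial value contributes at most [eps]. *)
pose K := Num.max (G (T + 1)) 1.
have K0 : 0 < K by rewrite lt_max ltr01 orbT.
near=> t.
have Tt : T + 1 < t by near: t; apply: nbhs_pinfty_gt; exact: num_real.
have t0 : 0 < t by apply: le_lt_trans Tt; rewrite addr_ge0.
have tK : K / eps <= t `^ a.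
  have Kt : (K / eps) `^ a^-1 <= t by near: t; apply: nbhs_pinfty_ge; exact: num_real.
  have -> : K / eps = ((K / eps) `^ a^-1) `^ a.
    by rewrite -powRrM mulVf ?gt_eqF// powRr1// divr_ge0 ?ltW.
  by apply: ge0_ler_powR; rewrite ?nnegrE ?powR_ge0 ?ltW.
rewrite -lerBlDl -(ler_pM2l (powR_gt0 a t0)).
apply: (@le_trans _ _ K).
  by rewrite (le_trans (niG _ _ TT (ltW Tt)))// le_max lexx.
by rewrite -ler_pdivrMr.
Unshelve. all: by end_near. Qed.

(** The one-sided bound is applied to [q] and to [- q]; half of [eps] pays for the distance of
    [a q + t q'] to [l], half for the transient. *)
Lemma cvgy_euler_ode (a T l : R) q dq : 0 < a -> 0 <= T ->
  (forall t, T < t -> is_derive t 1 q (dq t)) ->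
  (a * q t + t * dq t) @[t --> +oo] --> l ->
  q t @[t --> +oo] --> l / a.
Proof.
move=> a0 T0 qdq ql; apply/cvgrPdist_le => /= eps eps0.
have ea0 : 0 < eps / 2 * a by rewrite mulr_gt0// divr_gt0.
move/cvgrPdist_le : ql => /(_ _ ea0)[S [_ Sl]].
pose V := Num.max S T.
have V0 : 0 <= V by rewrite le_max T0 orbT.
have VT t : V < t -> T < t by rewrite gt_max => /andP[].
have Vl t : V < t -> `|l - (a * q t + t * dq t)| <= eps / 2 * a.
  by rewrite gt_max => /andP[? _]; exact: Sl.
have up := @cvgy_euler_ode_le a V (l / a + eps / 2) q dq a0 V0
  (fun t Vt => qdq t (VT t Vt)) _ (eps / 2) (divr_gt0 eps0 (ltr0Sn _ 1)).
have lo := @cvgy_euler_ode_le a V (- (l / a) + eps / 2) (- q) (- dq) a0 V0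
  (fun t Vt => is_deriveN (qdq t (VT t Vt))) _ (eps / 2) (divr_gt0 eps0 (ltr0Sn _ 1)).
have al : a * (l / a) = l by rewrite mulrC divfK// gt_eqF.
near=> t; rewrite ler_distlC.
apply/andP; split.
- have : (- q) t <= - (l / a) + eps / 2 + eps / 2.
    near: t; apply: lo => t /Vl; rewrite ler_norml => /andP[h1 h2].
    by rewrite /= !fctE mulrDr !mulrN al; lra.
  by rewrite fctE; lra.
- have : q t <= l / a + eps / 2 + eps / 2.
    near: t; apply: up => t /Vl; rewrite ler_norml => /andP[h1 h2].
    by rewrite mulrDr al; lra.
  lra.
Unshelve. all: by end_near. Qed.

(** * Primitives on a half-line *)

Lemma integral_primitive T F : (forall t, T <= t -> {for t, continuous F}) ->
  exists2 G : R -> R, (forall t, T < t -> is_derive t 1 G (F t)) &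
  forall t, T < t -> G t = (\int[lebesgue_measure]_(s in `[T, t]) F s)%R.
Proof.
move=> cF; pose G t := (\int[lebesgue_measure]_(s in `[T, t]) F s)%R.
exists G => // t Tt.
have tt : t < t + 1 by rewrite ltrDl.
(* The interval reaches past [t], so that [t] is an interior point for the fundamental theorem of
   calculus. *)
have iF : lebesgue_measure.-integrable `[T, t + 1] (EFin \o F).
  apply: continuous_compact_integrable; first exact: segment_compact.
  apply: continuous_in_subspaceT => s; rewrite inE/= in_itv/= => /andP[Ts _].
  exact: cF.
have [dG GF] : derivable G t 1 /\ derive1 G t = F t.
  exact: (continuous_FTC1_closed tt iF Tt (cF _ (ltW Tt))).
by split; [exact: dG|rewrite -derive1E; exact: GF].
Qed.

(** The primitive starts at [T > T0] because [F] may fail to be continuous at [T0]; nonnegativity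
    bounds it by the integral over the whole half-line. *)
Lemma integrable_primitive_bounded T0 T F : T0 < T ->
  (forall t, T0 < t -> {for t, continuous F}) ->
  (forall t, T0 < t -> 0 <= F t) ->
  (\int[lebesgue_measure]_(t in `[T0, +oo[) (F t)%:E < +oo)%E ->
  exists2 G : R -> R, (forall t, T < t -> is_derive t 1 G (F t)) &
  exists M, forall t, T < t -> 0 <= G t <= M.
Proof.
move=> T0T cF F0 Foo.
have [|G GF GE] := @integral_primitive T F.
  by move=> t Tt; apply: cF; exact: lt_le_trans Tt.
exists G => //.
(* Dropping the null endpoint makes the domain open, where continuity gives measurability. *)
have iFoo : (\int[lebesgue_measure]_(t in `]T0, +oo[) (F t)%:E < +oo)%E.
  rewrite integral_itv_obnd_cbnd//.
  apply/measurable_realfun.measurable_EFinP; apply: measurable_realfun.open_continuous_measurable_fun.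
    exact: interval_open.
  by move=> t; rewrite inE/= in_itv/= andbT => /cF.
exists (fine (\int[lebesgue_measure]_(t in `]T0, +oo[) (F t)%:E)) => t Tt.
rewrite GE// /Rintegral.
have Ft0 s : [set` `[T, t]] s -> (0 <= (F s)%:E)%E.
  by rewrite /= in_itv/= => /andP[Ts _]; rewrite lee_fin F0// (lt_le_trans T0T).
have le : (\int[lebesgue_measure]_(s in `[T, t]) (F s)%:E <=
    \int[lebesgue_measure]_(s in `]T0, +oo[) (F s)%:E)%E.
  apply: ge0_subset_integral => //.
  - apply/measurable_realfun.measurable_EFinP; apply: measurable_realfun.open_continuous_measurable_fun.
      exact: interval_open.
    by move=> s; rewrite inE/= in_itv/= andbT => /cF.
  - by move=> s; rewrite /= in_itv/= andbT lee_fin => /F0.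
  - by move=> s; rewrite /= !in_itv/= andbT => /andP[Ts _]; exact: lt_le_trans Ts.
rewrite fine_ge0/=; last exact: integral_ge0.
apply: fine_le => //.
  by rewrite ge0_fin_numE; [exact: le_lt_trans iFoo|exact: integral_ge0].
rewrite ge0_fin_numE//; apply: integral_ge0 => s.
by rewrite /= in_itv/= andbT lee_fin => /F0.
Qed.

End RealFunctions.

(** * Inner products *)

Section InnerProduct.
Context {R : realType} {V : normedModType R} (ip : inner_product V).
Implicit Types (x y z : V) (a : R).
Local Notation "'<< x , y >>" := (inner ip x y) (format "''<<' x ,  y >>").

Lemma innerDl x y z : '<<x + y, z>> = '<<x, z>> + '<<y, z>>.
Proof. by rewrite -[x in LHS]scale1r inner_linl mul1r. Qed.

Lemma inner0l z : '<<0, z>> = 0.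
Proof. by apply: (addrI '<<0, z>>); rewrite -innerDl !addr0. Qed.

Lemma innerZl a x z : '<<a *: x, z>> = a * '<<x, z>>.
Proof. by rewrite -[a *: x]addr0 inner_linl inner0l addr0. Qed.

Lemma innerNl x z : '<<- x, z>> = - '<<x, z>>.
Proof. by rewrite -scaleN1r innerZl mulN1r. Qed.

Lemma innerBl x y z : '<<x - y, z>> = '<<x, z>> - '<<y, z>>.
Proof. by rewrite innerDl innerNl. Qed.

Lemma innerDr x y z : '<<x, y + z>> = '<<x, y>> + '<<x, z>>.
Proof. by rewrite inner_sym innerDl !(inner_sym _ x). Qed.

Lemma innerZr a x z : '<<x, a *: z>> = a * '<<x, z>>.
Proof. by rewrite inner_sym innerZl (inner_sym _ x). Qed.

Lemma innerNr x z : '<<x, - z>> = - '<<x, z>>.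
Proof. by rewrite inner_sym innerNl (inner_sym _ x). Qed.

Lemma innerBr x y z : '<<x, y - z>> = '<<x, y>> - '<<x, z>>.
Proof. by rewrite innerDr innerNr. Qed.

Definition innerE := (innerDl, innerDr, innerNl, innerNr, innerZl, innerZr).

Lemma cauchy_schwarz x y : `|'<<x, y>>| <= `|x| * `|y|.
Proof.
suff h u v : '<<u, v>> <= `|u| * `|v|.
  by rewrite ler_norml h andbT lerNl -innerNl -[`|x|]normrN.
have [->|u0] := eqVneq u 0; first by rewrite inner0l normr0 mul0r.
have [->|v0] := eqVneq v 0; first by rewrite inner_sym inner0l normr0 mulr0.
have uv : 0 < `|u| * `|v| by rewrite mulr_gt0 ?normr_gt0.
rewrite -(ler_pM2l uv) -subr_ge0.
(* This square equals [2 |u| |v| (|u| |v| - <u, v>)]. *)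
have : 0 <= '<<`|v| *: u - `|u| *: v, `|v| *: u - `|u| *: v>>.
  by rewrite inner_norm sqr_ge0.
rewrite !innerE !inner_norm (inner_sym _ v u).
rewrite (_ : _ + _ = 2 * (`|u| * `|v| * (`|u| * `|v|) - `|u| * `|v| * '<<u, v>>)).
  by rewrite pmulr_rge0.
ring.
Qed.

Lemma cvg_inner {I : Type} {F : set_system I} {FF : Filter F} (u v : I -> V) x y :
  u i @[i --> F] --> x -> v i @[i --> F] --> y ->
  '<<u i, v i>> @[i --> F] --> '<<x, y>>.
Proof.
move=> ux vy; apply/subr_cvg0; apply/norm_cvg0P.
have h : (`|u i - x| * `|v i| + `|x| * `|v i - y|) @[i --> F] --> (0 : R).
  rewrite (_ : 0 = 0 * `|y| + `|x| * 0); last by rewrite mul0r mulr0 addr0.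
  have d0 (w : I -> V) z : w i @[i --> F] --> z -> `|w i - z| @[i --> F] --> (0 : R).
    by move=> wz; apply/norm_cvg0P; apply/subr_cvg0.
  apply: cvgD; apply: cvgM; [exact: d0|exact: cvg_norm|exact: cvg_cst|exact: d0].
apply: squeeze_cvgr (cvg_cst 0) h; near=> i; rewrite normr_ge0/=.
have -> : '<<u i, v i>> - '<<x, y>> = '<<u i - x, v i>> + '<<x, v i - y>>.
  by rewrite innerBl innerBr addrA subrK.
by rewrite (le_trans (ler_normD _ _))// lerD// cauchy_schwarz.
Unshelve. all: by end_near. Qed.

Lemma is_derive_continuous (u : R -> V) du (t : R) :
  is_derive t 1 u du -> {for t, continuous u}.
Proof. by move=> [/derivable1_diffP /differentiable_continuous]. Qed.

Lemma is_derive_inner (u v : R -> V) du dv (t : R) :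
  is_derive t 1 u du -> is_derive t 1 v dv ->
  is_derive t 1 (fun s => '<<u s, v s>>) ('<<du, v t>> + '<<u t, dv>>).
Proof.
move=> udu vdv.
have cv := is_derive_continuous vdv.
have sh : (h *: 1 + t) @[h --> 0^'] --> t.
  apply: cvg_trans (cvg_app _ (cvg_within _)) _.
  have : {for (0 : R), continuous (fun h : R => h *: (1 : R) + t)}.
    by apply: continuousD => ?; [exact: scalel_continuous|exact: cvg_cst].
  by rewrite /prop_for /continuous_at /= scale0r add0r.
case: udu => udu; rewrite /derive => Eu; case: vdv => vdv; rewrite /derive => Ev.
have c : (h^-1 *: (((fun s => '<<u s, v s>>) \o shift t) (h *: 1)
    - '<<u t, v t>>)) @[h --> 0^'] --> '<<du, v t>> + '<<u t, dv>>.
  (* Leibniz splitting of the difference quotient; [v] is evaluated at the shifted time, hence the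
     use of its continuity [cv]. *)
  rewrite (_ : (fun h => _) = (fun h =>
     '<<h^-1 *: ((u \o shift t) (h *: 1) - u t), v (h *: 1 + t)>> +
     '<<u t, h^-1 *: ((v \o shift t) (h *: 1) - v t)>>)).
    apply: cvgD; apply: cvg_inner.
    - by rewrite -Eu.
    - by apply: cvg_comp sh cv.
    - exact: cvg_cst.
    - by rewrite -Ev.
  apply/funext => h; rewrite /= innerZl innerZr -mulrDr innerBl innerBr addrA subrK.
  by [].
split; first exact: cvgP c.
exact: (cvg_lim _ c).
Qed.

Lemma is_derive_comp_diff (f : V -> R) (u : R -> V) du (t : R) :
  differentiable f (u t) -> is_derive t 1 u du ->
  is_derive t 1 (f \o u) ('d f (u t) du).
Proof.
move=> df [udu Eu].
have dU : differentiable u t by apply/derivable1_diffP.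
have dfu : differentiable (f \o u) t by exact: differentiable_comp.
split; first exact/derivable1_diffP.
by rewrite -Eu !deriveE// diff_comp.
Qed.

(** The derivative of [f] at [x] along [y - x] is a limit of difference quotients with step [h]
    decreasing to 0, and convexity bounds each of them by [f y - f x] when [h <= 1]. *)
Lemma convex_gradient_le (f : V -> R) (g : V -> V) x y :
  is_gradient ip f g -> convex_fun f -> f x + '<<g x, y - x>> <= f y.
Proof.
move=> gf cf; have [df dfE] := gf x.
rewrite -lerBrDl -dfE -deriveE//.
have dq : derivable f x (y - x) by exact: diff_derivable.
have c := cvg_dnbhs_at_right dq.
rewrite /derive -(cvg_lim _ c)//.
apply: limr_le; first exact: cvgP c.
near=> h.
have h0 : 0 < h by near: h; exact: nbhs_right_gt.
have h1 : h <= 1 by near: h; exact: nbhs_right_le.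
rewrite /= -[_ *: _]/(h^-1 * _) ler_pdivrMl//.
have /(cf y x) : 0 <= h <= 1 by rewrite ltW.
rewrite (_ : h *: y + (1 - h) *: x = h *: (y - x) + x); first by lra.
by rewrite scalerBl scale1r scalerBr addrA addrAC.
Unshelve. all: by end_near. Qed.

End InnerProduct.

(** * Weak limits *)

(** The values eventually lie in a compact segment, and a cluster point of an ultrafilter is a limit
    of it. *)
Lemma ultra_bounded_cvg {R : realType} {I : Type} {U : set_system I}
    {UU : UltraFilter U} (f : I -> R) (M : R) :
  (\forall i \near U, `|f i| <= M) -> exists l : R, f i @[i --> U] --> l.
Proof.
move=> fM.
have UM : fmap f U [set` `[- M, M]].
  by apply: filterS fM => i; rewrite /= in_itv/= ler_norml.
have [l [_ cl]] := @segment_compact R (- M) M (fmap f U) _ UM.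
exists l => A Al.
have [//|UnA] := in_ultra_setVsetC (f @^-1` A) UU.
have : fmap f U (~` A) by exact: UnA.
by move=> /cl /(_ Al)[r []].
Qed.

(* The representing vector minimizes [|y|^2 - 2 phi y]. *)
Lemma riesz_representation {R : realType} {V : completeNormedModType R}
    (ip : inner_product V) (phi : V -> R) (M : R) :
  (forall a x y, phi (a *: x + y) = a * phi x + phi y) ->
  (forall x, `|phi x| <= M * `|x|) ->
  exists w, forall y, phi y = inner ip w y.
Proof.
move=> phiL phiM; pose J y := inner ip y y - 2 * phi y.
have JM y : - M ^+ 2 <= J y.
  rewrite /J inner_norm; have := phiM y; rewrite ler_norml => /andP[_ h].
  have : 0 <= (`|y| - M) ^+ 2 by exact: sqr_ge0.
  by rewrite sqrrB; nra.
pose m := inf (range J).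
have hi : has_inf (range J).
  by split; [exists (J 0), 0|exists (- M ^+ 2) => _ [y _ <-]; exact: JM].
have mJ y : m <= J y by apply: ge_inf; [case: hi|exists y].
have /choice[u uJ] n : exists y, J y < m + n.+1%:R^-1.
  have n0 : (0 : R) < n.+1%:R^-1 by rewrite invr_gt0.
  by have [_ [y _ <-] Jy] := inf_adherent n0 hi; exists y.
(* Parallelogram law: the linear part of [J] cancels, so near-minimal points are close to each
   other. *)
have Jmid x y : `|x - y| ^+ 2 = 2 * J x + 2 * J y - 4 * J (2^-1 *: (x + y)).
  rewrite -(inner_norm ip) /J.
  have -> : phi (2^-1 *: (x + y)) = 2^-1 * (phi x + phi y).
    have := phiL 1 x y; rewrite scale1r mul1r => <-.
    have := phiL 2^-1 (x + y) 0; rewrite addr0.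
    by have := phiL (- 1) 0 0; rewrite scaleN1r oppr0 addr0 => ? ->; lra.
  by rewrite !innerE (inner_sym _ y x); field.
have uu N n : (N <= n)%N -> `|u N - u n| ^+ 2 < 4 * N.+1%:R^-1.
  move=> Nn; rewrite Jmid.
  have := uJ N; have := uJ n; have := mJ (2^-1 *: (u N + u n)).
  have : (n.+1%:R^-1 : R) <= N.+1%:R^-1 by rewrite lef_pV2 ?posrE// ler_nat.
  move: (J (u N)) (J (u n)) (J _) (n.+1%:R^-1) (N.+1%:R^-1) => a b c d k.
  by lra.
have /cvg_ex[w uw] : cvg (u n @[n --> \oo]).
  apply/cauchy_cvgP/cauchy_exP => e e0.
  have e24 : 0 < e ^+ 2 / 4 by rewrite divr_gt0 ?exprn_gt0.
  have [N _ Ne] := near_infty_natSinv_lt (PosNum e24).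
  exists (u N); exists N => // n Nn.
  rewrite -ball_normE /ball_ /=.
  rewrite -(ltr_pXn2r (ltn0Sn 1)) ?nnegrE ?(ltW e0)//.
  apply: lt_trans (uu N n Nn) _.
  have := Ne N (leqnn N); rewrite /=; move: (N.+1%:R^-1) (e ^+ 2) => a b; lra.
exists w => h; apply/eqP; rewrite -subr_eq0; apply/eqP.
pose B := phi h - inner ip w h; rewrite -/B.
(* Since [J (s h + u n) >= m > J (u n) - 1 / (n + 1)], this follows in the limit for every [s]. *)
have key s : 0 <= s ^+ 2 * inner ip h h - 2 * (s * B).
  have c : (s ^+ 2 * inner ip h h - 2 * (s * (phi h - inner ip (u n) h)) + n.+1%:R^-1)
      @[n --> \oo] --> s ^+ 2 * inner ip h h - 2 * (s * B) + 0.
    apply: cvgD; last exact: cvg_harmonic.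
    apply: cvgB; first exact: cvg_cst.
    apply: cvgM; first exact: cvg_cst.
    apply: cvgM; first exact: cvg_cst.
    apply: cvgB; first exact: cvg_cst.
    apply: cvg_inner => //; exact: cvg_cst.
  rewrite -[leRHS]addr0 -(cvg_lim _ c)//.
  apply: limr_ge; first exact: cvgP c.
  near=> n; have := uJ n; have := mJ (s *: h + u n).
  rewrite /J phiL !innerE (inner_sym _ h (u n)).
  by move: (n.+1%:R^-1) => k; lra.
have A0 : 0 <= inner ip h h by rewrite inner_norm sqr_ge0.
move: A0 key; move: (inner ip h h) => A A0 key.
have A1 : 0 < A + 1 by lra.
(* A near-optimal [s]; the added 1 avoids a division by zero when [h = 0]. *)
have := key (B / (A + 1)).
rewrite (_ : _ - _ = - (B ^+ 2 * ((A + 2) / (A + 1) ^+ 2))); last first.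
  by field; rewrite gt_eqF.
rewrite oppr_ge0 pmulr_lle0; last by rewrite divr_gt0 ?exprn_gt0// ltr_wpDl.
by move=> B0; apply/eqP; rewrite -sqrf_eq0 eq_le B0 sqr_ge0.
Unshelve. all: by end_near. Qed.

(** * Weak compactness and Opial's lemma *)

Section Opial.
Context {R : realType} {V : completeNormedModType R} (ip : inner_product V).

(** Weak compactness of balls in ultrafilter form: the limits of the inner products with each [y]
    form a bounded linear functional, which Riesz represents. *)
Lemma ultra_bounded_weak_cvg {I : Type} {U : set_system I}
    {UU : UltraFilter U} (x : I -> V) (M : R) :
  (\forall i \near U, `|x i| <= M) ->
  exists w, forall y, inner ip (x i) y @[i --> U] --> inner ip w y.
Proof.
move=> xM.
have /choice[phi phiP] y : exists l : R, inner ip (x i) y @[i --> U] --> l.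
  apply: (@ultra_bounded_cvg _ _ _ _ _ (M * `|y|)); apply: filterS xM => i xi.
  by rewrite (le_trans (cauchy_schwarz _ _ _))// ler_wpM2r.
have phiL a y z : phi (a *: y + z) = a * phi y + phi z.
  apply: (@norm_cvg_unique _ R^o _ _ _ _ (phiP (a *: y + z))) => /=.
  rewrite (_ : (fun i => _) = (fun i => a * inner ip (x i) y + inner ip (x i) z)).
    by apply: cvgD => //; apply: cvgM => //; exact: cvg_cst.
  by apply/funext => i; rewrite !innerE.
have phiM y : `|phi y| <= M * `|y|.
  rewrite -(cvg_lim _ (cvg_norm (phiP y)))//.
  apply: limr_le; first exact: cvgP (cvg_norm (phiP y)).
  apply: filterS xM => i xi.
  by rewrite (le_trans (cauchy_schwarz _ _ _))// ler_wpM2r.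
have [w wP] := riesz_representation ip phiL phiM.
by exists w => y; rewrite -wP.
Qed.

(** If the weak limit [w] along one ultrafilter were not the limit at infinity, another ultrafilter
    would avoid a neighbourhood of some [<w, y>]; its weak limit [v] lies in [S] too, and the
    convergence of distances forces [v = w]. *)
Lemma opial (S : set V) (x : R -> V) (M : R) :
  (\forall t \near +oo, `|x t| <= M) ->
  (forall z, S z -> cvg (`|x t - z| ^+ 2 @[t --> +oo])) ->
  (forall (U : set_system R) w, UltraFilter U -> +oo `<=` U ->
     (forall y, inner ip (x t) y @[t --> U] --> inner ip w y) -> S w) ->
  exists2 xs, S xs & weak_cvg_pinfty ip x xs.
Proof.
move=> xM cS wS.
have wlim (U : set_system R) : UltraFilter U -> +oo `<=` U ->
    exists w, forall y, inner ip (x t) y @[t --> U] --> inner ip w y.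
  by move=> UU sU; apply: (@ultra_bounded_weak_cvg _ _ _ _ M); exact: sU.
have [U [UU sU]] := ultraFilterLemma (proper_pinfty_nbhs (R := R)).
have [w ww] := wlim U UU sU.
have Sw := wS U w UU sU ww.
exists w => // y A Ay.
apply: contrapT => nA.
pose B := (fun t => inner ip (x t) y) @^-1` A.
(* Failure of convergence means that the complement of [B] meets every neighbourhood of infinity. *)
have PF : ProperFilter (within (~` B) (+oo : set_system R)).
  apply: Build_ProperFilter_ex => P wP.
  apply: contrapT => nP; apply: nA.
  have wP' : \forall t \near +oo%R, (~` B) t -> P t by exact: wP.
  change (\forall t \near +oo%R, B t); move: wP'; apply: filterS => t Pt.
  by apply: contrapT => nB; apply: nP; exists t; exact: Pt.
have [W [WU sW]] := ultraFilterLemma PF.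
have sW' : +oo `<=` W.
  by move=> C Coo; apply: sW; move: Coo; apply: filterS => t Ct _.
have [v vv] := wlim W WU sW'.
have Sv := wS W v WU sW' vv.
have vw : v = w.
  (* Up to a constant this is half the difference of the squared distances to [w] and [v], so it
     converges; its limit is then read along [W] and along [U]. *)
  have [l hl] : exists l : R, inner ip (x t) (v - w) @[t --> +oo] --> l.
    have /cvg_ex[a ha] := cS _ Sv; have /cvg_ex[b hb] := cS _ Sw.
    exists ((b - a + (inner ip v v - inner ip w w)) / 2).
    rewrite (_ : (fun t => _) = (fun t =>
      (`|x t - w| ^+ 2 - `|x t - v| ^+ 2 + (inner ip v v - inner ip w w)) / 2)).
      apply: cvgM; last exact: cvg_cst.
      by apply: cvgD; [exact: cvgB|exact: cvg_cst].
    apply/funext => t; rewrite -!(inner_norm ip) !innerE.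
    by rewrite (inner_sym _ v (x t)) (inner_sym _ w (x t)); field.
  have lv : l = inner ip v (v - w).
    apply: (@norm_cvg_unique _ R^o _ _ _ _ _ (vv _)) => /=.
    by move=> C /hl; exact: sW'.
  have lw : l = inner ip w (v - w).
    apply: (@norm_cvg_unique _ R^o _ _ _ _ _ (ww _)) => /=.
    by move=> C /hl; exact: sU.
  apply/eqP; rewrite -subr_eq0 -normr_eq0 -sqrf_eq0 -(inner_norm ip).
  by rewrite innerBl -lv -lw subrr.
have WB : W B by apply: (vv y); rewrite vw.
have WnB : W (~` B) by apply: sW; exact: withinT.
have /filter_ex[t [Bt nBt]] : W (B `&` ~` B) by exact: filterI.
exact: nBt Bt.
Qed.

End Opial.

(** * Energy estimates *)

Section ScalarEstimates.
Context {R : realType}.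
Implicit Types (F G : R -> R) (t a b c : R).

Lemma is_derive1D F G t a b : is_derive t 1 F a -> is_derive t 1 G b ->
  is_derive t 1 (fun s => F s + G s) (a + b).
Proof. exact: is_deriveD. Qed.

Lemma is_derive1M F G t a b : is_derive t 1 F a -> is_derive t 1 G b ->
  is_derive t 1 (fun s => F s * G s) (F t * b + G t * a).
Proof. exact: is_deriveM. Qed.

Lemma is_derive1_cst c t : is_derive t 1 (fun=> c) 0.
Proof. exact: is_derive_cst. Qed.

Lemma is_derive1_id t : is_derive t 1 (fun s : R => s) 1.
Proof. exact: is_derive_id. Qed.

Lemma is_derive1Ml F t a c : is_derive t 1 F a ->
  is_derive t 1 (fun s => c * F s) (c * a).
Proof.
move=> dF; apply: is_derive_eq (is_derive1M (is_derive1_cst c t) dF) _.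
by rewrite mulr0 addr0.
Qed.

(** As [A] is a primitive of the weight [a], the product [(1 + E) exp (- C A)] is nonincreasing. *)
Lemma gronwall_bounded (T C B : R) (E dE a A : R -> R) : 0 <= C ->
  (forall t, T < t -> is_derive t 1 E (dE t)) ->
  (forall t, T < t -> is_derive t 1 A (a t)) ->
  (forall t, T < t -> A t <= B) ->
  (forall t, T < t -> dE t <= C * a t * (1 + E t)) ->
  exists M, forall t, T + 1 < t -> E t <= M.
Proof.
move=> C0 EdE Aa AB dEa.
pose G t := (1 + E t) * expR (- C * A t).
pose dG t := (1 + E t) * (expR (- C * A t) * (- C * a t)) + expR (- C * A t) * (0 + dE t).
have GdG t : T < t -> is_derive t 1 G (dG t).
  move=> Tt; apply: is_derive1M.
    exact: is_derive1D (is_derive1_cst 1 t) (EdE t Tt).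
  exact: is_derive1_comp (is_derive_expR _) (is_derive1Ml (- C) (Aa t Tt)).
have niG := is_derive_le0_nonincreasing GdG.
have TT : T < T + 1 by rewrite ltrDl.
exists (`|G (T + 1)| * expR (C * B)) => t Tt.
have Tt' := lt_trans TT Tt.
have : G t <= G (T + 1).
  apply: niG => //; last exact: ltW.
  move=> s Ts; rewrite /dG.
  rewrite (_ : _ + _ = expR (- C * A s) * (dE s - C * a s * (1 + E s))); last by ring.
  by rewrite mulr_ge0_le0 ?expR_ge0// subr_le0 dEa.
move=> /le_trans /(_ (ler_norm _)); rewrite /G mulNr expRN ler_pdivrMr ?expR_gt0//.
move=> h; apply: (@le_trans _ _ (1 + E t)); first by rewrite lerDr.
apply: le_trans h _; rewrite ler_wpM2l// ler_expR.
by rewrite ler_wpM2l// AB.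
Qed.

(** Here [d], [u], [du] stand for [|x - z|], [t |w|], [t <x - z, w>]. Completing the square bounds
    the form below by [m d^2 + (u - lam d)^2 / 2], and [u^2 <= 2 (u - lam d)^2 + 2 lam^2 d^2] yields
    the constant. *)
Lemma energy_quadratic_coercive (alpha lam d u du : R) :
  0 < lam -> lam < alpha - 1 -> 0 <= d -> 0 <= u -> `|du| <= d * u ->
  d ^+ 2 + u ^+ 2 <= (4 + (2 * lam ^+ 2 + 1) / (lam * (alpha - 1 - lam) / 2)) *
    (lam * (alpha - 1) / 2 * d ^+ 2 + lam * du + u ^+ 2 / 2).
Proof.
move=> lam0 lam1 d0 u0; rewrite ler_norml => /andP[h _].
set m := lam * (alpha - 1 - lam) / 2.
have m0 : 0 < m by rewrite divr_gt0// mulr_gt0// subr_gt0.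
have q1 : m * d ^+ 2 + (u - lam * d) ^+ 2 / 2 <=
    lam * (alpha - 1) / 2 * d ^+ 2 + lam * du + u ^+ 2 / 2.
  have : lam * - (d * u) <= lam * du by rewrite ler_wpM2l// ltW.
  by rewrite /m; lra.
have l0 : 0 <= (2 * lam ^+ 2 + 1) / m.
  by apply: divr_ge0 (ltW m0); have := sqr_ge0 lam; lra.
have K0 : 0 <= 4 + (2 * lam ^+ 2 + 1) / m by rewrite addr_ge0.
apply: le_trans (ler_wpM2l K0 q1).
rewrite [leRHS](_ : _ = 4 * (m * d ^+ 2) + 2 * (u - lam * d) ^+ 2 +
  (2 * lam ^+ 2 + 1) * d ^+ 2 +
  (2 * lam ^+ 2 + 1) / m * ((u - lam * d) ^+ 2 / 2)); last first.
  by field; rewrite gt_eqF.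
have r1 : 0 <= (2 * lam ^+ 2 + 1) / m * ((u - lam * d) ^+ 2 / 2).
  by rewrite mulr_ge0// divr_ge0// sqr_ge0.
have r2 : 0 <= m * d ^+ 2 by rewrite mulr_ge0 ?sqr_ge0// ltW.
have r3 : 0 <= (u - 2 * lam * d) ^+ 2 by exact: sqr_ge0.
move: r1 r2; move: (_ / m * _) (m * _) => k1 k2 r1 r2.
by lra.
Qed.

(** Scalar form of the bound on [denergy]: [F] is [f x - f z], [Dg] is [<x - z, grad f x>], [xx] and
    [pp] are [|x'|^2] and [|p|^2]; [nd], [nw], [np], [ne] are the norms of [x - z], [w], [p], [e],
    and [De], [we], [pe] the inner products with [e]. *)
Lemma energy_dissipation_le (alpha beta lam t F Dg xx pp nd nw np ne De we pe M : R) :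
  0 < beta -> 2 < lam -> lam < alpha - 1 ->
  0 < t -> 2 * beta <= t -> beta * alpha <= t -> beta * (alpha - 2) <= (lam - 2) * t ->
  0 <= F -> F <= Dg -> 0 <= xx -> pp = np ^+ 2 ->
  0 <= nd -> 0 <= nw -> 0 <= np -> 0 <= ne ->
  `|De| <= nd * ne -> `|we| <= nw * ne -> `|pe| <= np * ne -> t * ne <= M ->
  (2 * t + beta * (alpha - lam - 2)) * F - lam * (t - beta) * (Dg + De)
  - t * (alpha - 1 - lam) * xx - t * beta * (t - beta) * pp
  - (t ^+ 2 + t * (beta * (alpha - lam - 2))) * (we - beta * pe)
  <= - (beta / 4 * (t ^+ 2 * pp)) +
     (1 + lam + 4 * beta * M) * (t * ne) * (1 + (nd ^+ 2 + (t * nw) ^+ 2)).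
Proof.
move=> b0 l2 l1 t0 tb ta tl F0 FD xx0 -> nd0 nw0 np0 ne0 hDe hwe hpe aM.
set a := t * ne in aM *.
have a0 : 0 <= a by rewrite mulr_ge0// ltW.
have M0 : 0 <= M by exact: le_trans aM.
set del := t ^+ 2 + t * (beta * (alpha - lam - 2)).
have del0 : 0 <= del.
  rewrite /del expr2 -mulrDr mulr_ge0 ?(ltW t0)//.
  have : beta * (- 1) <= beta * (alpha - lam - 2) by rewrite ler_pM2l//; lra.
  lra.
have del2 : del <= 2 * t ^+ 2.
  rewrite /del expr2 -mulrDr mulrCA ler_pM2l//.
  have : beta * (alpha - lam - 2) <= beta * alpha by rewrite ler_pM2l//; lra.
  lra.
(* By [F <= Dg] this is at most [((2 - lam) t + beta (alpha - 2)) F], whose coefficient is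
   nonpositive for large [t] because [lam > 2]. *)
have s1 : (2 * t + beta * (alpha - lam - 2)) * F - lam * (t - beta) * Dg <= 0.
  have : lam * (t - beta) * F <= lam * (t - beta) * Dg.
    by rewrite ler_wpM2l// mulr_ge0; lra.
  have : (2 * t + beta * (alpha - lam - 2) - lam * (t - beta)) * F <= 0.
    by rewrite mulr_le0_ge0//; lra.
  lra.
have s2 : 0 <= t * (alpha - 1 - lam) * xx.
  by rewrite mulr_ge0// mulr_ge0 ?(ltW t0)//; lra.
(* Uses [t - beta >= t / 2]. Half of this dissipation survives in the conclusion, the other half
   pays for [s5]. *)
have s3 : beta / 2 * (t * np) ^+ 2 <= t * beta * (t - beta) * np ^+ 2.
  rewrite exprMn mulrA ler_wpM2r ?sqr_ge0//.
  rewrite expr2 (_ : beta / 2 * (t * t) = t * beta * (t / 2)); last by field.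
  by apply: ler_wpM2l (mulr_ge0 (ltW t0) (ltW b0)) _ _ _; lra.
have delM (u v : R) : `|u| <= v * ne -> 0 <= v -> `|del * u| <= 2 * (t * v) * a.
  move=> uv v0; rewrite normrM (ger0_norm del0).
  apply: (@le_trans _ _ (2 * t ^+ 2 * (v * ne))); first exact: ler_pM.
  by rewrite /a le_eqVlt; apply/orP; left; apply/eqP; ring.
have s4 : - (del * we) <= (1 + (t * nw) ^+ 2) * a.
  have := delM _ _ hwe nw0; rewrite ler_norml => /andP[h _].
  have : 2 * (t * nw) * a <= (1 + (t * nw) ^+ 2) * a.
    by rewrite ler_wpM2r//; have := sqr_ge0 (t * nw - 1); lra.
  lra.
(* Young's inequality leaves the quadratic error [4 beta a^2], which the bound [a <= M] makes linear
   in [a]. *)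
have s5 : beta * (del * pe) <= beta / 4 * (t * np) ^+ 2 + 4 * beta * M * a.
  have := delM _ _ hpe np0; rewrite ler_norml => /andP[_ h].
  have : beta * (del * pe) <= beta * (2 * (t * np) * a) by rewrite ler_pM2l.
  have : 0 <= beta / 4 * (t * np - 4 * a) ^+ 2.
    by rewrite mulr_ge0 ?sqr_ge0// divr_ge0// ltW.
  have : 4 * beta * (a * a) <= 4 * beta * (M * a).
    by rewrite ler_pM2l ?mulr_gt0// ler_wpM2r.
  lra.
have s6 : - (lam * (t - beta) * De) <= lam * (1 + nd ^+ 2) * a.
  have : `|lam * (t - beta) * De| <= lam * t * (nd * ne).
    rewrite normrM ger0_norm; last by rewrite mulr_ge0; lra.
    by apply: ler_pM => //; [rewrite mulr_ge0; lra|rewrite ler_wpM2l; lra].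
  rewrite ler_norml => /andP[h _].
  have : lam * nd * a <= lam * (1 + nd ^+ 2) * a.
    rewrite ler_wpM2r// ler_wpM2l; [by []|lra|].
    by have := sqr_ge0 (nd - 1); have := sqr_ge0 nd; lra.
  rewrite /a; lra.
have s7 : 0 <= lam * a * (t * nw) ^+ 2.
  by rewrite mulr_ge0 ?sqr_ge0// mulr_ge0//; lra.
have s8 : 0 <= a * nd ^+ 2 by rewrite mulr_ge0 ?sqr_ge0.
have s9 : 0 <= 4 * beta * M * a * (nd ^+ 2 + (t * nw) ^+ 2).
  by rewrite mulr_ge0 ?addr_ge0 ?sqr_ge0// mulr_ge0// mulr_ge0// mulr_ge0// ltW.
rewrite -/del.
have tn : t ^+ 2 * np ^+ 2 = (t * np) ^+ 2 by rewrite exprMn.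
rewrite tn.
move: s1 s2 s3 s4 s5 s6 s7 s8 s9; clear.
set Q := (t * np) ^+ 2; set W := (t * nw) ^+ 2; set D := nd ^+ 2.
lra.
Qed.

End ScalarEstimates.

(** * The trajectory: Lyapunov function and distance to minimizers *)

Section Trajectory.
Context {R : realType} {H : normedModType R} (ip : inner_product H).
Variables (t0 : R) (f : H -> R) (gradf : H -> H) (e : R -> H).
Variables (alpha beta : R) (x : R -> H).
Hypotheses (t0_gt0 : 0 < t0) (gradfP : is_gradient ip f gradf)
  (convf : convex_fun f) (alpha_gt3 : 3 < alpha) (beta_gt0 : 0 < beta).
Hypotheses (dx : forall t, t0 < t -> derivable x t 1)
  (ddx : forall t, t0 < t -> derivable (derive1 x) t 1)
  (dp : forall t, t0 < t -> derivable (fun s => gradf (x s) + e s) t 1).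
Hypothesis ode : forall t, t0 < t ->
  derive1 (derive1 x) t + (alpha / t) *: derive1 x t
  + beta *: derive1 (fun s => gradf (x s) + e s) t + gradf (x t) + e t = 0.

Let p s := gradf (x s) + e s.
Let w s := derive1 x s + beta *: p s.
Local Notation "'<< u , v >>" := (inner ip u v) (format "''<<' u ,  v >>").

Let is_derive_x t : t0 < t -> is_derive t 1 x (derive1 x t).
Proof. by move=> /dx xt; split => //; rewrite derive1E. Qed.

Let is_derive_p t : t0 < t -> is_derive t 1 p (derive1 p t).
Proof. by move=> /dp pt; split => //; rewrite derive1E. Qed.

Let is_derive_w t : t0 < t ->
  is_derive t 1 w (- (alpha / t) *: derive1 x t - p t).
Proof.
move=> t0t; have dxt : is_derive t 1 (derive1 x) (derive1 (derive1 x) t).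
  by split; [exact: ddx|rewrite derive1E].
have -> : - (alpha / t) *: derive1 x t - p t =
    derive1 (derive1 x) t + beta *: derive1 p t.
  apply/eqP; rewrite eq_sym -subr_eq0; apply/eqP.
  rewrite -[RHS](ode t0t) scaleNr opprB opprK /p -!addrA; congr (_ + _).
  by rewrite [RHS]addrC -!addrA.
exact: is_deriveD dxt (is_deriveZ beta (is_derive_p t0t)).
Qed.

Let is_derive_D z t : t0 < t -> is_derive t 1 (fun s => x s - z) (derive1 x t).
Proof.
move=> t0t; rewrite -[derive1 x t]subr0.
exact: is_deriveB (is_derive_x t0t) (is_derive_cst z t 1).
Qed.

(* The last three terms expand
   [|lam (x - z) + t w|^2 / 2 + lam (alpha - 1 - lam) / 2 |x - z|^2],
   so the energy is affine in [lam]. *)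
Definition energy lam z t :=
  (t ^+ 2 + t * (beta * (alpha - lam - 2))) * (f (x t) - f z)
  + lam * (alpha - 1) / 2 * '<<x t - z, x t - z>>
  + lam * (t * '<<x t - z, w t>>) + t ^+ 2 * '<<w t, w t>> / 2.

(** In the derivative of [energy] the terms [<x - z, x'>] and [<x', p>] cancel, the latter thanks to
    the coefficient [beta * (alpha - lam - 2)]. The last factor is [<x', e>], written through [w]
    because the energy controls [t |w|]. *)
Definition denergy lam z t :=
  (2 * t + beta * (alpha - lam - 2)) * (f (x t) - f z)
  - lam * (t - beta) * ('<<x t - z, gradf (x t)>> + '<<x t - z, e t>>)
  - t * (alpha - 1 - lam) * '<<derive1 x t, derive1 x t>>
  - t * beta * (t - beta) * '<<p t, p t>>
  - (t ^+ 2 + t * (beta * (alpha - lam - 2))) * ('<<w t, e t>> - beta * '<<p t, e t>>).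

Lemma is_derive_energy lam z t : t0 < t ->
  is_derive t 1 (energy lam z) (denergy lam z t).
Proof.
move=> t0t; have tn0 : t != 0 by rewrite gt_eqF// (lt_trans t0_gt0).
have dt2 : is_derive t 1 (fun s : R => s ^+ 2) (2 * t).
  apply: is_derive_eq (is_derive1M (is_derive1_id t) (is_derive1_id t)) _.
  by rewrite !mulr1; lra.
have d1 : is_derive t 1 (fun s => s ^+ 2 + s * (beta * (alpha - lam - 2)))
    (2 * t + beta * (alpha - lam - 2)).
  apply: is_derive1D dt2 _.
  apply: is_derive_eq (is_derive1M (is_derive1_id t) (is_derive1_cst _ t)) _.
  by rewrite mulr0 add0r mulr1.
have d2 : is_derive t 1 (fun s => f (x s) - f z) '<<gradf (x t), derive1 x t>>.
  have [df dfE] := gradfP (x t).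
  have := is_deriveB (is_derive_comp_diff df (is_derive_x t0t)) (is_derive_cst (f z) t 1).
  by rewrite subr0 dfE.
have d3 := is_derive_inner ip (is_derive_D z t0t) (is_derive_D z t0t).
have d4 := is_derive_inner ip (is_derive_D z t0t) (is_derive_w t0t).
have d5 := is_derive_inner ip (is_derive_w t0t) (is_derive_w t0t).
have := is_derive1D (is_derive1D (is_derive1D (is_derive1M d1 d2)
    (is_derive1Ml (lam * (alpha - 1) / 2) d3))
    (is_derive1Ml lam (is_derive1M (is_derive1_id t) d4)))
    (is_derive1M (is_derive1M dt2 d5) (is_derive1_cst 2^-1 t)).
move=> /is_derive_eq; apply.
rewrite /denergy /w /p.
move: (f (x t) - f z) (x t - z) (derive1 x t) (gradf (x t)) (e t) => F D v g h.
rewrite !innerE (inner_sym _ v D) (inner_sym _ g v) (inner_sym _ h v) (inner_sym _ h g).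
by field.
Qed.

Variables (T B M : R) (A : R -> R).
Hypotheses (t0T : t0 <= T)
  (dA : forall t, T < t -> is_derive t 1 A (t * `|e t|))
  (AB : forall t, T < t -> 0 <= A t <= B)
  (eM : forall t, T < t -> t * `|e t| <= M).

(** For large [t] the weight of [f x - f z] is at least [t^2 / 2] and the quadratic part is
    coercive, so the energy dominates the squares in the error of [energy_dissipation_le]. *)
Lemma energy_estimates lam z : is_minimizer f z -> 2 < lam -> lam < alpha - 1 ->
  exists2 T', T <= T' & exists C K, [/\ 0 <= C, 0 <= K & forall t, T' < t ->
    [/\ denergy lam z t <= - (beta / 4 * (t ^+ 2 * '<<p t, p t>>))
                          + C * (t * `|e t|) * (1 + energy lam z t),
       '<<x t - z, x t - z>> <= K * energy lam z t,
       t ^+ 2 * (f (x t) - f z) <= 2 * energy lam z t &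
       0 <= energy lam z t]].
Proof.
move=> zmin lam2 lam1.
pose K := 4 + (2 * lam ^+ 2 + 1) / (lam * (alpha - 1 - lam) / 2).
pose C1 := 1 + lam + 4 * beta * M.
(* These are the lower bounds on [t] asked by [energy_dissipation_le]; the last one is divided by
   [lam - 2 > 0]. *)
pose T' := Num.max T (Num.max (2 * beta)
  (Num.max (beta * alpha) (beta * (alpha - 2) / (lam - 2)))).
have K0 : 0 < K.
  rewrite addr_gt0// divr_gt0//; first by have := sqr_ge0 lam; lra.
  by rewrite divr_gt0// mulr_gt0; lra.
have M0 : 0 <= M.
  have T1 : T < T + 1 by rewrite ltrDl.
  apply: le_trans (eM T1); rewrite mulr_ge0//.
  by have := lt_le_trans t0_gt0 t0T; lra.
have C10 : 0 <= C1.
  have : 0 <= 4 * beta * M by rewrite mulr_ge0// mulr_ge0// ltW.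
  by rewrite /C1; lra.
exists T'; first by rewrite le_max lexx.
exists (C1 * (1 + K)), K; split; [by rewrite mulr_ge0//; lra|exact: ltW|].
move=> t; rewrite !gt_max => /and4P[Tt tb ta]; rewrite ltr_pdivrMr; last by lra.
move=> tl.
have t0t : t0 < t by exact: le_lt_trans Tt.
have tgt0 : 0 < t by exact: lt_trans t0t.
have F0 : 0 <= f (x t) - f z by rewrite subr_ge0.
have FD : f (x t) - f z <= '<<x t - z, gradf (x t)>>.
  have := convex_gradient_le (x t) z gradfP convf.
  by rewrite !innerE !(inner_sym _ (gradf (x t))); lra.
have coer : `|x t - z| ^+ 2 + (t * `|w t|) ^+ 2 <= K *
    (lam * (alpha - 1) / 2 * `|x t - z| ^+ 2 + lam * (t * '<<x t - z, w t>>)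
    + (t * `|w t|) ^+ 2 / 2).
  apply: energy_quadratic_coercive => //; [lra|by rewrite mulr_ge0// ltW|].
  by rewrite normrM (gtr0_norm tgt0) mulrCA ler_wpM2l ?cauchy_schwarz// ltW.
pose q := lam * (alpha - 1) / 2 * `|x t - z| ^+ 2 + lam * (t * '<<x t - z, w t>>)
    + (t * `|w t|) ^+ 2 / 2.
have del2 : t ^+ 2 / 2 <= t ^+ 2 + t * (beta * (alpha - lam - 2)).
  have hb : beta * (- 1) <= beta * (alpha - lam - 2) by rewrite ler_pM2l//; lra.
  have -> : t ^+ 2 / 2 = t * (t / 2) by field.
  by rewrite expr2 -mulrDr ler_pM2l//; lra.
have EE : energy lam z t =
    (t ^+ 2 + t * (beta * (alpha - lam - 2))) * (f (x t) - f z) + q.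
  by rewrite /energy /q !inner_norm exprMn; ring.
have q0 : 0 <= q.
  rewrite -(pmulr_rge0 _ K0); apply: le_trans coer.
  by rewrite addr_ge0 ?sqr_ge0.
have EF : t ^+ 2 / 2 * (f (x t) - f z) + q <= energy lam z t.
  by rewrite EE lerD2r ler_wpM2r.
have tF0 : 0 <= t ^+ 2 / 2 * (f (x t) - f z).
  by rewrite mulr_ge0// divr_ge0// sqr_ge0.
have qE : q <= energy lam z t by lra.
have KqE : K * q <= K * energy lam z t by rewrite ler_pM2l.
split.
- apply: le_trans.
    apply: (@energy_dissipation_le R alpha beta lam t _ _ _ _
      `|x t - z| `|w t| `|p t| `|e t| _ _ _ M) => //; try exact: ltW.
    + by rewrite [leRHS]mulrC ltW.
    + by rewrite inner_norm sqr_ge0.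
    + by rewrite inner_norm.
    + exact: cauchy_schwarz.
    + exact: cauchy_schwarz.
    + exact: cauchy_schwarz.
    + exact: eM.
  (* By coercivity [|x - z|^2 + (t |w|)^2 <= K E], and [1 + K E <= (1 + K) (1 + E)]. *)
  rewrite -/C1 lerD2l (_ : C1 * (1 + K) * (t * `|e t|) * (1 + energy lam z t) =
    C1 * (t * `|e t|) * ((1 + K) * (1 + energy lam z t))); last by ring.
  apply: ler_wpM2l; first by rewrite mulr_ge0// mulr_ge0// ltW.
  have : 0 <= energy lam z t + K by lra.
  move: coer; rewrite -/q; lra.
- by rewrite inner_norm; have := sqr_ge0 (t * `|w t|); move: coer; rewrite -/q; lra.
- by lra.
- by lra.
Qed.

Let is_derive_continuous1 (u : R -> R) (du t : R) :
  is_derive t 1 u du -> {for t, continuous u}.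
Proof. exact: (@is_derive_continuous R R^o). Qed.

Let continuous_t2pp t : t0 < t -> {for t, continuous (fun s : R => s ^+ 2 * '<<p s, p s>>)}.
Proof.
move=> t0t; apply: is_derive_continuous1.
exact: is_derive1M (is_derive_inner ip (is_derive_p t0t) (is_derive_p t0t)).
Qed.

Let continuous_Dp z t : t0 < t -> {for t, continuous (fun s : R => '<<x s - z, p s>>)}.
Proof.
move=> t0t; apply: is_derive_continuous1.
exact: (is_derive_inner ip (is_derive_D z t0t) (is_derive_p t0t)).
Qed.

(** Once Gronwall bounds the energy [E] by [N], its derivative is at most
    [- (beta / 4) t^2 |p|^2 + k t |e|]. Hence [E - k A] is nonincreasing and bounded below, and [E]
    converges with [A]; keeping the dissipation in the monotone quantity bounds [P]. *)
Lemma energy_cvg lam z : is_minimizer f z -> 2 < lam -> lam < alpha - 1 ->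
  cvg (energy lam z t @[t --> +oo]) /\
  exists2 T', t0 < T' & exists2 L, 0 <= L & exists2 P : R -> R,
    (forall t, T' < t -> is_derive t 1 P (t ^+ 2 * '<<p t, p t>>)) &
    forall t, T' < t -> [/\ '<<x t - z, x t - z>> <= L,
      t ^+ 2 * (f (x t) - f z) <= L & P t <= L].
Proof.
move=> zmin lam2 lam1.
have [T1 TT1 [C [K [C0 K0 est]]]] := energy_estimates zmin lam2 lam1.
have t0T1 : t0 <= T1 by exact: le_trans TT1.
have dE t : T1 < t -> is_derive t 1 (energy lam z) (denergy lam z t).
  by move=> T1t; apply: is_derive_energy; exact: le_lt_trans T1t.
have dA1 t : T1 < t -> is_derive t 1 A (t * `|e t|).
  by move=> T1t; apply: dA; exact: le_lt_trans T1t.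
have AB1 t : T1 < t -> 0 <= A t <= B.
  by move=> T1t; apply: AB; exact: le_lt_trans T1t.
have pp0 t : 0 <= beta / 4 * (t ^+ 2 * '<<p t, p t>>).
  rewrite mulr_ge0 ?divr_ge0 ?(ltW beta_gt0)// mulr_ge0 ?sqr_ge0//.
  by rewrite inner_norm sqr_ge0.
have [N EN] : exists N, forall t, T1 + 1 < t -> energy lam z t <= N.
  have AB2 t : T1 < t -> A t <= B by move=> /AB1/andP[].
  apply: (gronwall_bounded C0 dE dA1 AB2) => t /est[h _ _ _].
  by apply: le_trans h _; rewrite gerDr oppr_le0.
pose T2 := T1 + 1.
have T12 t : T2 < t -> T1 < t by apply: lt_trans; rewrite ltrDl.
have E0 t : T2 < t -> 0 <= energy lam z t by move=> /T12/est[].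
have N0 : 0 <= N.
  have h : T2 < T2 + 1 by rewrite ltrDl.
  exact: le_trans (E0 _ h) (EN _ h).
have dE2 t : T2 < t -> denergy lam z t <=
    - (beta / 4 * (t ^+ 2 * '<<p t, p t>>)) + C * (1 + N) * (t * `|e t|).
  move=> T2t; have [h _ _ _] := est t (T12 t T2t).
  apply: le_trans h _.
  rewrite lerD2l [leRHS]mulrAC; apply: ler_wpM2l; last by rewrite lerD2l EN.
  by rewrite !mulr_ge0// ltW// (lt_trans t0_gt0)// (le_lt_trans t0T1)// T12.
have T2t0 : t0 < T2 by rewrite (le_lt_trans t0T1)// ltrDl.
have [P dP _] : exists2 P : R -> R,
    (forall t, T2 < t -> is_derive t 1 P (t ^+ 2 * '<<p t, p t>>)) &
    forall t, T2 < t -> P t =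
      (\int[lebesgue_measure]_(s in `[T2, t]) (s ^+ 2 * '<<p s, p s>>))%R.
  apply: integral_primitive => t T2t; apply: continuous_t2pp.
  exact: lt_le_trans T2t.
pose k := C * (1 + N).
have k0 : 0 <= k by rewrite mulr_ge0// addr_ge0.
have dEA t : T2 < t -> is_derive t 1 (fun s => energy lam z s + (- k) * A s)
    (denergy lam z t + (- k) * (t * `|e t|)).
  by move=> /T12 T1t; exact: is_derive1D (dE t T1t) (is_derive1Ml (- k) (dA1 t T1t)).
have dEAP t : T2 < t ->
    is_derive t 1 (fun s => energy lam z s + (- k) * A s + beta / 4 * P s)
    (denergy lam z t + (- k) * (t * `|e t|) + beta / 4 * (t ^+ 2 * '<<p t, p t>>)).
  by move=> T2t; exact: is_derive1D (dEA t T2t) (is_derive1Ml (beta / 4) (dP t T2t)).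
have kA t : T2 < t -> - (k * B) <= (- k) * A t.
  by move=> /T12/AB1/andP[_ h]; rewrite mulNr lerN2 ler_wpM2l.
split.
  have cEA : cvg ((energy lam z t + (- k) * A t) @[t --> +oo]).
    apply: (@nonincreasing_bounded_cvgy _ T2 _ (- (k * B))).
      apply: (is_derive_le0_nonincreasing dEA) => t T2t.
      by have := dE2 t T2t; have := pp0 t; rewrite -/k; lra.
    by move=> t T2t; have := E0 t T2t; have := kA t T2t; lra.
  have cA : cvg (A t @[t --> +oo]).
    apply: (@nondecreasing_bounded_cvgy _ T1 _ B) => [|t /AB1/andP[]//].
    apply: (is_derive_ge0_nondecreasing dA1) => t T1t.
    by rewrite mulr_ge0// ltW// (lt_trans t0_gt0)// (le_lt_trans t0T1).
  rewrite (_ : energy lam z = (fun t => energy lam z t + (- k) * A t + k * A t)).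
    by apply: is_cvgD => //; apply: is_cvgM => //; exact: is_cvg_cst.
  by apply/funext => t; rewrite mulNr subrK.
pose G t := energy lam z t + (- k) * A t + beta / 4 * P t.
have niG : forall s t, T2 < s -> s <= t -> G t <= G s.
  apply: (is_derive_le0_nonincreasing dEAP) => t T2t.
  by have := dE2 t T2t; rewrite -/k; lra.
(* A sum of three nonnegative terms, one for each of the bounds to be proved. *)
pose L := K * N + 2 * N + 4 / beta * (`|G (T2 + 1)| + k * B).
have B0 : 0 <= B.
  have /AB1/andP[h1 h2] : T1 < T1 + 1 by rewrite ltrDl.
  exact: le_trans h2.
have KN0 : 0 <= K * N by rewrite mulr_ge0.
have b40 : 0 <= 4 / beta by rewrite divr_ge0// ltW.
have L30 : 0 <= 4 / beta * (`|G (T2 + 1)| + k * B).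
  by apply: mulr_ge0 => //; apply: addr_ge0 => //; exact: mulr_ge0.
have T2S : T2 < T2 + 1 by rewrite ltrDl.
exists (T2 + 1); first exact: lt_trans T2S.
exists L; first by rewrite /L; lra.
exists P => [t T3t|t T3t]; first exact/dP/(lt_trans T2S).
have T2t := lt_trans T2S T3t.
have [_ hD hF hE] := est t (T12 t T2t).
have hN := EN t T2t.
split.
- apply: le_trans hD _.
  have : K * energy lam z t <= K * N by rewrite ler_wpM2l.
  by rewrite /L; lra.
- by rewrite /L; lra.
- have : beta / 4 * P t <= `|G (T2 + 1)| + k * B.
    have hG : energy lam z t + (- k) * A t + beta / 4 * P t <= G (T2 + 1).
      exact: niG _ _ T2S (ltW T3t).
    have := le_trans hG (ler_norm _); have := kA t T2t.
    by move: (`|_|) => g; lra.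
  move=> /(ler_wpM2l b40) h.
  have -> : P t = 4 / beta * (beta / 4 * P t) by field; rewrite gt_eqF.
  apply: le_trans h _.
  by rewrite /L; lra.
Qed.

Lemma dist_cvg z : is_minimizer f z ->
  cvg (`|x t - z| ^+ 2 @[t --> +oo]) /\ f (x t) @[t --> +oo] --> f z.
Proof.
move=> zmin.
(* The interval from 2 to [alpha - 1] has length [alpha - 3 > 0]; the witnesses cut it into
   thirds. *)
have [l1 [l2 [l12 l21 l2a]]] : exists l1 l2 : R, [/\ 2 < l1, l1 < l2 & l2 < alpha - 1].
  by exists ((alpha + 3) / 3), ((2 * alpha) / 3); move: alpha_gt3; split; lra.
have l22 := lt_trans l12 l21; have l1a := lt_trans l21 l2a.
have l210 : l2 - l1 != 0 by rewrite subr_eq0 gt_eqF.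
have [c2 _] := energy_cvg zmin l22 l2a.
have [c1 [S t0S [L L0 [P dP bnd]]]] := energy_cvg zmin l12 l1a.
have S0 : 0 < S by exact: lt_trans t0S.
have cinv : (L * t^-1) @[t --> +oo] --> (0 : R).
  rewrite -(mulr0 L); apply: cvgM; first exact: cvg_cst.
  by apply/gtr0_cvgV0; [apply: nbhs_pinfty_gt; exact: num_real|exact: cvg_id].
have ctF : (t * (f (x t) - f z)) @[t --> +oo] --> (0 : R).
  apply: squeeze_cvgr (cvg_cst 0) cinv; near=> t.
  have St : S < t by near: t; apply: nbhs_pinfty_gt; exact: num_real.
  have t0' : 0 < t by exact: lt_trans St.
  rewrite mulr_ge0 ?(ltW t0') ?subr_ge0//=.
  by have [_ h _] := bnd t St; rewrite ler_pdivlMr// mulrAC -expr2.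
have cF : f (x t) @[t --> +oo] --> f z.
  apply/subr_cvg0; apply: squeeze_cvgr (cvg_cst 0) ctF; near=> t.
  have t1 : 1 <= t by near: t; apply: nbhs_pinfty_ge; exact: num_real.
  by rewrite subr_ge0 zmin/= ler_peMl ?subr_ge0.
split => //.
(* [k] is, up to a vanishing term, the slope of the energy in [lam]; moreover
   [k + (alpha - 1) beta Q = (alpha - 1) q + t q']. *)
pose k t := (alpha - 1) / 2 * '<<x t - z, x t - z>> + t * '<<x t - z, w t>>.
have ck : cvg (k t @[t --> +oo]).
  rewrite (_ : k = (fun t => (energy l2 z t - energy l1 z t) / (l2 - l1)
     + beta * (t * (f (x t) - f z)))); last first.
    by apply/funext => t; rewrite /k /energy; field.
  apply: is_cvgD.
    exact: is_cvgM (is_cvgB c2 c1) (is_cvg_cst _).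
  by apply: is_cvgM; [exact: is_cvg_cst|exact: cvgP ctF].
have [Q dQ _] : exists2 Q : R -> R,
    (forall t, S < t -> is_derive t 1 Q '<<x t - z, p t>>) &
    forall t, S < t -> Q t =
      (\int[lebesgue_measure]_(s in `[S, t]) '<<x s - z, p s>>)%R.
  apply: integral_primitive => t St; apply: continuous_Dp.
  exact: lt_le_trans St.
have cQ : cvg (Q t @[t --> +oo]).
  (* By Young's inequality [|<x - z, p>|] is at most [|x - z|^2 / t^2 + t^2 |p|^2]; as
     [|x - z|^2 <= L], the derivative of [P - L / t] dominates it. *)
  have dG t : S < t -> is_derive t 1 (fun s => P s + (- L) * s^-1)
      (t ^+ 2 * '<<p t, p t>> + (- L) * (- t ^- 2)).
    move=> St; apply: is_derive1D; first exact: dP.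
    apply: is_derive1Ml.
    have tn0 : t != 0 by rewrite gt_eqF// (lt_trans S0).
    apply: is_derive_eq (is_deriveV tn0 (is_derive1_id t)) _.
    by rewrite /GRing.scale/= mulr1.
  apply: (is_derive_dominated_cvgy dQ dG (M := L)) => t St; last first.
    have [_ _ h] := bnd t St.
    have : 0 <= L * t^-1 by rewrite mulr_ge0// invr_ge0 ltW// (lt_trans S0).
    by lra.
  have t0' : 0 < t by exact: lt_trans St.
  apply: le_trans (cauchy_schwarz _ _ _) _.
  have [hD _ _] := bnd t St.
  rewrite !inner_norm in hD *.
  have h : 0 <= (`|x t - z| * t^-1 - t * `|p t|) ^+ 2 by exact: sqr_ge0.
  have e1 : (`|x t - z| * t^-1 - t * `|p t|) ^+ 2 = `|x t - z| ^+ 2 * t ^- 2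
      - 2 * (`|x t - z| * `|p t|) + t ^+ 2 * `|p t| ^+ 2.
    by field; rewrite gt_eqF.
  have h2 : `|x t - z| ^+ 2 * t ^- 2 <= L * t ^- 2.
    by rewrite ler_wpM2r// invr_ge0 sqr_ge0.
  have h3 : 0 <= L * t ^- 2 by rewrite mulr_ge0// invr_ge0 sqr_ge0.
  have h4 : 0 <= t ^+ 2 * `|p t| ^+ 2 by rewrite mulr_ge0 ?sqr_ge0.
  rewrite e1 in h; move: h h2 h3 h4.
  rewrite mulrNN; move: (L * _) (_ * t ^- 2) (_ * `|p t|) (t ^+ 2 * _) => a b c d.
  by lra.
(* Adding [beta Q] turns the derivative [<x - z, x'>] into [<x - z, w>]; the squared distance is
   recovered at the end as [2 (q - beta Q)]. *)
pose q t := '<<x t - z, x t - z>> / 2 + beta * Q t.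
have dq t : S < t -> is_derive t 1 q '<<x t - z, w t>>.
  move=> St; have t0t := lt_trans t0S St.
  have dD := is_derive_inner ip (is_derive_D z t0t) (is_derive_D z t0t).
  apply: is_derive_eq (is_derive1D (is_derive1M dD (is_derive1_cst 2^-1 t))
    (is_derive1Ml beta (dQ t St))) _.
  rewrite /w; move: (x t - z) (derive1 x t) (p t) => D v r.
  by rewrite innerDr innerZr (inner_sym _ v D); field.
have [l ql] : exists l : R, ((alpha - 1) * q t + t * '<<x t - z, w t>>) @[t --> +oo] --> l.
  suff /cvg_ex : cvg (((alpha - 1) * q t + t * '<<x t - z, w t>>) @[t --> +oo]) by [].
  rewrite (_ : (fun t => _) = (fun t => k t + (alpha - 1) * beta * Q t)); last first.
    by apply/funext => t; rewrite /k /q; field.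
  by apply: is_cvgD => //; apply: is_cvgM => //; exact: is_cvg_cst.
have a1 : 0 < alpha - 1 by lra.
have cq := cvgy_euler_ode a1 (ltW S0) dq ql.
rewrite (_ : (fun t => _) = (fun t => 2 * (q t - beta * Q t))); last first.
  by apply/funext => t; rewrite /q inner_norm; field.
apply: is_cvgM; first exact: is_cvg_cst.
apply: is_cvgB; first exact: cvgP cq.
by apply: is_cvgM => //; exact: is_cvg_cst.
Unshelve. all: by end_near. Qed.

End Trajectory.

(* Testing [(s e)' = e + s e'] against the fixed increment of [s e] reduces the
   vector-valued mean value inequality to the scalar one. *)
Lemma weighted_norm_bounded {R : realType} {H : normedModType R}
    (ip : inner_product H) (t0 T a b : R) (e : R -> H) (A B : R -> R) :
  0 < t0 -> t0 < T ->
  (forall t, T < t -> derivable e t 1) ->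
  (forall t, T < t -> is_derive t 1 A (t * `|e t|)) ->
  (forall t, T < t -> is_derive t 1 B (t * `|derive1 e t|)) ->
  (forall t, T < t -> 0 <= A t <= a) -> (forall t, T < t -> 0 <= B t <= b) ->
  exists M, forall t, T + 1 < t -> t * `|e t| <= M.
Proof.
move=> t00 t0T de dA dB Aa Bb.
pose s0 := T + 1; have Ts0 : T < s0 by rewrite ltrDl.
(* A primitive of an upper bound of [|(s e)'|], since [|e| <= t0^-1 s |e|] for [s > t0]. *)
pose S t := t0^-1 * A t + B t.
pose N := t0^-1 * a + b.
have N0 : 0 <= N.
  have /andP[A0 A1] := Aa _ Ts0; have /andP[B0 B1] := Bb _ Ts0.
  apply: addr_ge0; last exact: le_trans B1.
  by apply: mulr_ge0; [rewrite invr_ge0 ltW|exact: le_trans A1].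
exists (N + s0 * `|e s0|) => t s0t.
have T0 : 0 < T by exact: lt_trans t0T.
have s00 : 0 < s0 by exact: lt_trans Ts0.
have tgt0 : 0 < t by exact: lt_trans s0t.
have Tt : T < t by exact: lt_trans s0t.
pose u := t *: e t - s0 *: e s0.
pose psi s := s * inner ip (e s) u + - `|u| * S s.
pose dpsi s := s * (inner ip (derive1 e s) u + inner ip (e s) 0)
  + inner ip (e s) u * 1 + - `|u| * (t0^-1 * (s * `|e s|) + s * `|derive1 e s|).
have dpsiP s : T < s -> is_derive s 1 psi (dpsi s).
  move=> Ts; have des : is_derive s 1 e (derive1 e s).
    by split; [exact: de|rewrite derive1E].
  apply: is_derive1D.
    exact: is_derive1M (is_derive1_id s) (is_derive_inner ip des (is_derive_cst u s 1)).
  exact: is_derive1Ml (is_derive1D (is_derive1Ml t0^-1 (dA s Ts)) (dB s Ts)).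
have dpsi0 s : T < s -> dpsi s <= 0.
  move=> Ts; rewrite /dpsi (inner_sym _ _ 0) inner0l addr0 mulr1.
  have sgt0 : 0 < s by exact: lt_trans Ts.
  have h1 : s * inner ip (derive1 e s) u <= s * (`|derive1 e s| * `|u|).
    by rewrite ler_pM2l// (le_trans (ler_norm _))// cauchy_schwarz.
  have h2 : inner ip (e s) u <= `|e s| * `|u|.
    by rewrite (le_trans (ler_norm _))// cauchy_schwarz.
  have h3 : `|e s| * `|u| <= t0^-1 * (s * `|e s|) * `|u|.
    rewrite ler_wpM2r// mulrA ler_peMl// ler_pdivlMl// mulr1.
    by rewrite ltW// (lt_trans t0T).
  move: h1 h2 h3; rewrite mulNr mulrDr opprD.
  move: (inner ip (derive1 e s) u) (inner ip (e s) u) => i1 i2.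
  rewrite [`|u| * (t0^-1 * _)]mulrC [`|u| * (s * _)]mulrC.
  by move: (t0^-1 * _ * _) (`|e s| * _) => k1 k2; lra.
have := is_derive_le0_nonincreasing dpsiP dpsi0 Ts0 (ltW s0t).
have Su : `|u| * (S t - S s0) <= `|u| * N.
  rewrite ler_wpM2l// /S /N.
  have /andP[A0 A1] := Aa _ Ts0; have /andP[B0 B1] := Bb _ Ts0.
  have /andP[_ A2] := Aa _ Tt; have /andP[_ B2] := Bb _ Tt.
  have ti : 0 <= t0^-1 by rewrite invr_ge0 ltW.
  have := ler_wpM2l ti A2; have := mulr_ge0 ti A0.
  by move: (t0^-1 * A t) (t0^-1 * A s0) (t0^-1 * a) => *; lra.
rewrite /psi => h.
(* The monotonicity of [psi] reads [<t e t - s0 e s0, u> <= |u| (S t - S s0)], and the left side is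
   [|u|^2]. *)
have uu : `|u| ^+ 2 <= `|u| * N.
  by rewrite -(inner_norm ip) {1}/u innerBl !innerZl; lra.
have uN : `|u| <= N.
  have [u0|u0] := eqVneq `|u| 0; first by rewrite u0.
  by move: uu; rewrite expr2 ler_pM2l// lt_def u0/=.
have -> : t * `|e t| = `|u + s0 *: e s0| by rewrite subrK normrZ gtr0_norm.
have -> : s0 * `|e s0| = `|s0 *: e s0| by rewrite normrZ gtr0_norm.
by rewrite (le_trans (ler_normD _ _))// lerD2r.
Qed.

(** The gradient inequality at [w] bounds [f (x i)] below by [f w + <g w, x i - w>], whose last term
    vanishes in the weak limit; thus [f w <= f z]. *)
Lemma weak_limit_minimizer {R : realType} {V : normedModType R}
    (ip : inner_product V) (f : V -> R) (g : V -> V) {I : Type}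
    {F : set_system I} {FF : ProperFilter F} (x : I -> V) z w :
  is_gradient ip f g -> convex_fun f -> is_minimizer f z ->
  f (x i) @[i --> F] --> f z ->
  (forall y, inner ip (x i) y @[i --> F] --> inner ip w y) ->
  is_minimizer f w.
Proof.
move=> gf cf zmin fx xw y; apply: le_trans (zmin y).
have c : (f w + (inner ip (x i) (g w) - inner ip w (g w))) @[i --> F] --> f w + 0.
  apply: cvgD; first exact: cvg_cst.
  by rewrite -(subrr (inner ip w (g w))); apply: cvgB => //; exact: cvg_cst.
have d : (f (x i) - (f w + (inner ip (x i) (g w) - inner ip w (g w)))) @[i --> F]
    --> f z - (f w + 0) by exact: cvgB.
rewrite -[leLHS]addr0 -subr_ge0 -(cvg_lim _ d)//.
apply: limr_ge; first exact: cvgP d.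
near=> i; rewrite subr_ge0 -innerBl inner_sym.
exact: convex_gradient_le.
Unshelve. all: by end_near. Qed.

(** * Weak convergence of the trajectory *)

Unset Implicit Arguments.

Theorem theorem6 (R : realType) (H : completeNormedModType R) (ip : inner_product H)
  (t0 : R) (f : H -> R) (gradf : H -> H) (e : R -> H) (alpha beta : R) (x : R -> H) :
  0 < t0 ->
  C2_with_gradient ip f gradf ->
  convex_fun f ->
  (exists z, is_minimizer f z) ->
  {within `[t0, +oo[, continuous e} ->
  (forall t, t0 < t -> derivable e t 1) ->
  {within `]t0, +oo[, continuous (derive1 e)} ->
  (\int[lebesgue_measure]_(t in `[t0, +oo[) (t * `|e t|)%:E < +oo)%E ->
  (\int[lebesgue_measure]_(t in `[t0, +oo[) (t * `|derive1 e t|)%:E < +oo)%E ->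
  3 < alpha -> 0 < beta ->
  (forall t, t0 < t -> derivable x t 1) ->
  (forall t, t0 < t -> derivable (derive1 x) t 1) ->
  (forall t, t0 < t -> derivable (fun s => gradf (x s) + e s) t 1) ->
  (forall t, t0 < t ->
     derive1 (derive1 x) t + (alpha / t) *: derive1 x t
     + beta *: derive1 (fun s => gradf (x s) + e s) t + gradf (x t) + e t = 0) ->
  exists2 xs : H, is_minimizer f xs & weak_cvg_pinfty ip x xs.
Proof.
move=> t00 [gradfP _] convf [z zmin] _ de cde ie ide al3 b0 dx ddx dp ode.
have tn (u : R -> H) t : {for t, continuous u} ->
    {for t, continuous (fun s : R => s * `|u s|)}.
  move=> cu; apply: cvgM; first exact: cvg_id.
  exact: cvg_norm cu.
(* The primitives start at [t0 + 1], away from [t0], as continuity of [derive1 e] is given on the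
   open half-line. *)
have t0T : t0 < t0 + 1 by rewrite ltrDl.
have tge0 (u : R -> H) t : t0 < t -> 0 <= t * `|u t|.
  by move=> t0t; rewrite mulr_ge0// ltW// (lt_trans t00).
have [A dA [a Aa]] : exists2 A : R -> R,
    (forall t, t0 + 1 < t -> is_derive t 1 A (t * `|e t|)) &
    exists a, forall t, t0 + 1 < t -> 0 <= A t <= a.
  apply: (integrable_primitive_bounded t0T _ (tge0 e) ie) => t t0t; apply: tn.
  by apply: differentiable_continuous; apply/derivable1_diffP; exact: de.
have [B dB [b Bb]] : exists2 B : R -> R,
    (forall t, t0 + 1 < t -> is_derive t 1 B (t * `|derive1 e t|)) &
    exists b, forall t, t0 + 1 < t -> 0 <= B t <= b.
  apply: (integrable_primitive_bounded t0T _ (tge0 (derive1 e)) ide) => t t0t.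
  apply: tn; move: cde; rewrite continuous_open_subspace; last exact: interval_open.
  by apply; rewrite inE/= in_itv/= t0t.
have [M eM] := weighted_norm_bounded ip t00 t0T
  (fun t Tt => de t (lt_trans t0T Tt)) dA dB Aa Bb.
(* The bound [eM] holds one unit after [t0 + 1], which fixes the common threshold. *)
have TT : t0 + 1 < t0 + 1 + 1 by rewrite ltrDl.
have t0T2 : t0 <= t0 + 1 + 1 by rewrite ltW// (lt_trans t0T).
have cvg_z y (ymin : is_minimizer f y) := dist_cvg t00 gradfP convf al3 b0 dx ddx dp ode
  t0T2 (fun t Tt => dA t (lt_trans TT Tt)) (fun t Tt => Aa t (lt_trans TT Tt)) eM ymin.
have [cz fz] := cvg_z z zmin.
have [T [N xN]] := cvgy_bounded cz.
(* [N] bounds [|x - z|^2], and [r <= 1 + r^2] for every real [r]. *)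
apply: (@opial _ _ ip (is_minimizer f) x (`|z| + (1 + N))).
- near=> t.
  have Tt : T < t by near: t; apply: nbhs_pinfty_gt; exact: num_real.
  have := xN t Tt; rewrite ger0_norm ?sqr_ge0// => h.
  rewrite -[x t](subrK z) addrC (le_trans (ler_normD _ _))// lerD2l.
  by have := sqr_ge0 (`|x t - z| - 1); have := sqr_ge0 `|x t - z|; lra.
- by move=> y /cvg_z[].
- move=> U w UU sU xw.
  apply: (weak_limit_minimizer (F := U) gradfP convf zmin _ xw).
  by move=> C /fz; exact: sU.
Unshelve. all: by end_near. Qed.
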